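(* If $W_1$ and $W_2$ are kernels satisfying $W_1+W_2=1$, then \[t(C_5,W_1)+t(C_5,W_2)=\sum_{i=1}^2\left[t(K_2,W_i)^5+5t(K_2,W_i)t(P_5,W_i)-5t(K_2,W_i)^2t(P_4,W_i)\right].\]
   Context: A kernel is a bounded measurable function $U:[0,1]^2\to\mathbb{R}$ with $U(x,y)=U(y,x)$. For a graph $H$, $t(H,U):=\int_{[0,1]^{V(H)}}\prod_{uv\in E(H)}U(x_u,x_v)\prod_{v\in V(H)}dx_v$. $P_k$ denotes the path on $k$ vertices and $C_5$ the $5$-cycle. *)

(* Defs.v *)
From HB Require Import structures.
From mathcomp Require Import all_boot all_order all_algebra.
From mathcomp Require Import all_classical all_reals all_analysis.

Set Implicit Arguments.
Unset Strict Implicit.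
Unset Printing Implicit Defensive.

Import Order.TTheory GRing.Theory Num.Theory.
Import numFieldNormedType.Exports.

Local Open Scope classical_set_scope.
Local Open Scope ring_scope.

(* The library equips n.-tuple T with the product sigma-algebra but not with a
   product measure.  tuple_measure m n is the n-fold power of m: it transports
   the binary product measure m \x m^(n-1) along T * T^(n-1) ~ T^n. *)
Section tuple_measure.
Context (d : measure_display) (T : measurableType d) (R : realType).

Definition pair_cons (n : nat) (p : T * n.-tuple T) : n.+1.-tuple T :=
  [tuple of p.1 :: p.2].

Definition uncons (n : nat) (x : n.+1.-tuple T) : T * n.-tuple T :=
  (thead x, [tuple of behead x]).

Lemma measurable_pair_cons n : measurable_fun setT (@pair_cons n).
Proof. exact: measurable_cons. Qed.

Lemma measurable_uncons n : measurable_fun setT (@uncons n).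
Proof.
apply: measurable_fun_pair; first exact: measurable_tnth.
exact: measurable_behead.
Qed.

Lemma pair_consK n : cancel (@pair_cons n) (@uncons n).
Proof.
by case=> a t; rewrite /uncons /pair_cons theadE; congr pair; exact: val_inj.
Qed.

Section cons_measure.
Variables (m : {sigma_finite_measure set T -> \bar R}) (n : nat).
Variable (mn : {sigma_finite_measure set (n.-tuple T) -> \bar R}).

Definition cons_measure : set (n.+1.-tuple T) -> \bar R :=
  pushforward (m \x mn)%E (@pair_cons n).

Let pm : {measure set (n.+1.-tuple T) -> \bar R} :=
  measure_function_pushforward__canonical__measure_function_Measure
    (m \x mn)%E (@measurable_pair_cons n).

HB.instance Definition _ := isMeasure.Build _ _ _ cons_measure
  (measure0 pm) (measure_ge0 pm) (@measure_semi_sigma_additive _ _ _ pm).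

Lemma sigma_finite_cons_measure : sigma_finite setT cons_measure.
Proof.
have /sigma_finiteP[F [TF ndF Foo]] := sigma_finiteT m.
have /sigma_finiteP[G [TG ndG Goo]] := sigma_finiteT mn.
exists (fun i => @uncons n @^-1` (F i `*` G i)) => [|i].
  rewrite -preimage_bigcup (_ : \bigcup_i _ = setT) ?preimage_setT//.
  apply/seteqP; split=> // -[x y] _.
  have [j _ Fjx] : (\bigcup_j F j) x by rewrite -TF.
  have [k _ Gky] : (\bigcup_k G k) y by rewrite -TG.
  exists (maxn j k) => //; split=> /=.
  - by move: x Fjx; exact/subsetPset/ndF/leq_maxl.
  - by move: y Gky; exact/subsetPset/ndG/leq_maxr.
have [mF Fi] := Foo i; have [mG Gi] := Goo i; split.
  rewrite -[X in measurable X]setTI; apply: measurable_uncons => //.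
  exact: measurableX.
rewrite /cons_measure /pushforward -comp_preimage.
rewrite (_ : _ \o _ = id); last by apply/funext => p; exact: pair_consK.
by rewrite preimage_id product_measure1E// lte_mul_pinfty// ge0_fin_numE.
Qed.

HB.instance Definition _ := Measure_isSigmaFinite.Build _ _ _ cons_measure
  sigma_finite_cons_measure.

End cons_measure.

Fixpoint tuple_measure (m : {sigma_finite_measure set T -> \bar R}) (n : nat) :
    {sigma_finite_measure set (n.-tuple T) -> \bar R} :=
  match n with
  | 0 => \d_([tuple] : 0.-tuple T)
  | k.+1 => cons_measure m (tuple_measure m k)
  end.

End tuple_measure.

Record sgraph := SGraph {
  vertex :> finType;
  adj : rel vertex;
  adj_sym : symmetric adj;
  adj_irrefl : irreflexive adj }.

Section graphs.
Variable n : nat.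

Definition complete_adj : rel 'I_n := fun u v => u != v.

Lemma complete_adj_sym : symmetric complete_adj.
Proof. by move=> u v; rewrite /complete_adj eq_sym. Qed.

Lemma complete_adj_irrefl : irreflexive complete_adj.
Proof. by move=> u; rewrite /complete_adj eqxx. Qed.

Definition complete_graph := SGraph complete_adj_sym complete_adj_irrefl.

Definition path_adj : rel 'I_n :=
  fun u v => (u.+1 == v :> nat) || (v.+1 == u :> nat).

Lemma path_adj_sym : symmetric path_adj.
Proof. by move=> u v; rewrite /path_adj orbC. Qed.

Lemma path_adj_irrefl : irreflexive path_adj.
Proof. by move=> u; rewrite /path_adj orbb; apply/negbTE; rewrite gtn_eqF. Qed.

(* n counts vertices, not edges *)
Definition path_graph := SGraph path_adj_sym path_adj_irrefl.

Definition cycle_adj : rel 'I_n := fun u v =>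
  (u != v) && ((u.+1 %% n == v :> nat) || (v.+1 %% n == u :> nat))%N.

Lemma cycle_adj_sym : symmetric cycle_adj.
Proof. by move=> u v; rewrite /cycle_adj eq_sym orbC. Qed.

Lemma cycle_adj_irrefl : irreflexive cycle_adj.
Proof. by move=> u; rewrite /cycle_adj eqxx. Qed.

(* meaningful for n >= 3 *)
Definition cycle_graph := SGraph cycle_adj_sym cycle_adj_irrefl.

End graphs.

Section kernels.
Variable R : realType.

(* U is a total function, but only its values on [0,1]^2 matter. *)
Definition is_kernel (U : R -> R -> R) : Prop :=
  [/\ measurable_fun (`[0, 1] `*` `[0, 1] : set (R * R)) (fun p => U p.1 p.2),
      exists M : R, {in `[0, 1] &, forall x y, `|U x y| <= M}
    & {in `[0, 1] &, forall x y, U x y = U y x}].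

Definition unit_cube (n : nat) : set (n.-tuple R) :=
  [set x | forall i, tnth x i \in `[0, 1]].

(* The coordinate x_v is tnth x (enum_rank v).  The condition on the ranks
   selects one orientation of each edge, so each edge contributes one factor. *)
Definition hom_density (H : sgraph) (U : R -> R -> R) : R :=
  \int[tuple_measure (@lebesgue_measure R) #|H|]_(x in @unit_cube #|H|)
    \prod_(e : H * H | adj e.1 e.2 && (enum_rank e.1 < enum_rank e.2)%N)
      U (tnth x (enum_rank e.1)) (tnth x (enum_rank e.2)).

End kernels.

(* Main.v *)
Require Import Defs.
From HB Require Import structures.
From mathcomp Require Import all_boot all_order all_algebra.
From mathcomp Require Import all_classical all_reals all_analysis.
From mathcomp Require Import measurable_realfun ring.

(* Write (A f)(x) for the integral of A(x,y) f(y) over y, and let V = 1 - W.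
   Replacing the last factor V of a cyclic product by 1 - W turns the cycle
   into a path (the constant kernel 1) minus a cycle whose factor W can be
   rotated to the front.  After five steps
     t(C_5,V) + t(C_5,W) = q04 - q13 + q22 - q31 + q40,
   where qij is the integral of W^i V^j 1.  The same substitution at the first
   V gives q_{i,j+1} = q_{0,j} q_{i,0} - q_{i+1,j}, so both sides of the
   theorem are polynomials in q10, q20, q30, q40, and these coincide. *)

Set Implicit Arguments.
Unset Strict Implicit.
Unset Printing Implicit Defensive.

Import Order.TTheory GRing.Theory Num.Theory.
Import numFieldNormedType.Exports.

Local Open Scope classical_set_scope.
Local Open Scope ring_scope.

(** * Bounded measurable functions and bounds on their integrals *)

Section bounded_measurable.
Context (R : realType) (d : measure_display) (T : measurableType d).

Definition bounded_measurable (f : T -> R) : Prop :=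
  measurable_fun setT f /\ exists M : R, forall x, `|f x| <= M.

Lemma bounded_measurable_cst (c : R) : bounded_measurable (fun=> c).
Proof. by split; [exact: measurable_cst|exists `|c|]. Qed.

Lemma bounded_measurableM (f g : T -> R) : bounded_measurable f ->
  bounded_measurable g -> bounded_measurable (fun x => f x * g x).
Proof.
move=> [mf [M fM]] [mg [N gN]]; split; first exact: measurable_funM.
by exists (M * N) => x; rewrite normrM ler_pM.
Qed.

Lemma bounded_measurableB (f g : T -> R) : bounded_measurable f ->
  bounded_measurable g -> bounded_measurable (fun x => f x - g x).
Proof.
move=> [mf [M fM]] [mg [N gN]]; split; first exact: measurable_funB.
by exists (M + N) => x; rewrite (le_trans (ler_normB _ _))// lerD.
Qed.

Lemma bounded_measurable_prod (I : Type) (r : seq I) (P : pred I)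
    (f : I -> T -> R) : (forall i, P i -> bounded_measurable (f i)) ->
  bounded_measurable (fun x => \prod_(i <- r | P i) f i x).
Proof.
move=> bf; elim: r => [|i r IH].
  by under eq_fun do rewrite big_nil; exact: bounded_measurable_cst.
under eq_fun do rewrite big_cons.
have [Pi|//] := boolP (P i).
by apply: bounded_measurableM => //; exact: bf.
Qed.

Lemma bounded_measurable_integrable (mu : {measure set T -> \bar R})
    (D : set T) (f : T -> R) : measurable D -> (mu D < +oo)%E ->
  bounded_measurable f -> mu.-integrable D (EFin \o f).
Proof.
move=> mD Dfin [mf [M fM]]; apply: measurable_bounded_integrable => //.
  exact: measurable_funTS.
by exists M; split; [exact: num_real|move=> N MN x _; exact: le_trans (ltW MN)].
Qed.

Lemma bounded_Rintegral (mu : {measure set T -> \bar R}) (D : set T)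
    (f : T -> R) (M : R) : measurable D -> (mu D < +oo)%E ->
  measurable_fun setT f -> (forall x, `|f x| <= M) ->
  `|\int[mu]_(x in D) f x| <= M * fine (mu D).
Proof.
move=> mD Dfin mf fM; have bf : bounded_measurable f by split; last by exists M.
have bc := bounded_measurable_cst M.
have bn : bounded_measurable (fun x => `|f x|).
  split; first exact: measurableT_comp.
  by exists M => x; rewrite normr_id.
rewrite (le_trans (le_normr_Rintegral mD _))//.
  exact: bounded_measurable_integrable.
rewrite -Rintegral_cst// le_Rintegral//; exact: bounded_measurable_integrable.
Qed.

End bounded_measurable.

Lemma bounded_measurable_comp (R : realType) (d d' : measure_display)
    (T : measurableType d) (T' : measurableType d') (f : T' -> R)
    (g : T -> T') : bounded_measurable f -> measurable_fun setT g ->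
  bounded_measurable (fun x => f (g x)).
Proof. by move=> [mf [M fM]] mg; split; [exact: measurableT_comp|exists M]. Qed.

(** * Fubini for real-valued integrals over rectangles of finite measure *)

Section fubini_on_rectangles.
Context (R : realType) (d1 d2 : measure_display).
Context (T1 : measurableType d1) (T2 : measurableType d2).
Variables (m2 : {sigma_finite_measure set T2 -> \bar R}) (D2 : set T2).
Hypotheses (mD2 : measurable D2) (fin2 : (m2 D2 < +oo)%E).

Section two_measures.
Variables (m1 : {sigma_finite_measure set T1 -> \bar R}) (D1 : set T1).
Hypotheses (mD1 : measurable D1) (fin1 : (m1 D1 < +oo)%E).
Variable f : T1 * T2 -> R.
Hypothesis bf : bounded_measurable f.

Let mD : measurable (D1 `*` D2). Proof. exact: measurableX. Qed.

Let intf : ((m1 \x m2)%E).-integrable setT (EFin \o f \_ (D1 `*` D2)).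
Proof.
rewrite -restrict_EFin; apply/integrable_restrict => //; rewrite setTI.
apply: bounded_measurable_integrable => //.
by rewrite /= product_measure1E// lte_mul_pinfty// ge0_fin_numE.
Qed.

(** Fubini is applied on the whole product to [f] extended by zero off the rectangle. Boundedness
    keeps the inner integral finite, so [fine] loses nothing. *)
Let f1 x : (\int[m2]_y (EFin \o f \_ (D1 `*` D2)) (x, y) =
  ((fun x => \int[m2]_(y in D2) f (x, y)) \_ D1 x)%:E)%E.
Proof.
have [xD|xD] := boolP (x \in D1); rewrite patchE ?(negbTE xD) ?xD.
  rewrite /Rintegral fineK; last first.
    apply: integrable_fin_num => //.
    apply: (@bounded_measurable_integrable _ _ _ _ _ (fun y => f (x, y))) => //.
    exact: bounded_measurable_comp bf (pair1_measurable x).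
  rewrite [RHS]integral_mkcond; apply: eq_integral => y _ /=.
  rewrite !patchE; have -> : ((x, y) \in D1 `*` D2) = (y \in D2).
    by rewrite in_setX /= xD.
  by case: ifP.
rewrite integral0_eq// => y _ /=; rewrite patchE in_setX/= (negbTE xD).
by [].
Qed.

Let f2 y : (\int[m1]_x (EFin \o f \_ (D1 `*` D2)) (x, y) =
  ((fun y => \int[m1]_(x in D1) f (x, y)) \_ D2 y)%:E)%E.
Proof.
have [yD|yD] := boolP (y \in D2); rewrite patchE ?(negbTE yD) ?yD.
  rewrite /Rintegral fineK; last first.
    apply: integrable_fin_num => //.
    apply: (@bounded_measurable_integrable _ _ _ _ _ (fun x => f (x, y))) => //.
    exact: bounded_measurable_comp bf (pair2_measurable y).
  rewrite [RHS]integral_mkcond; apply: eq_integral => x _ /=.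
  rewrite !patchE; have -> : ((x, y) \in D1 `*` D2) = (x \in D1).
    by rewrite in_setX /= yD andbT.
  by case: ifP.
rewrite integral0_eq// => x _ /=; rewrite patchE in_setX/= (negbTE yD) andbF.
by [].
Qed.

Lemma Rintegral_setX : \int[(m1 \x m2)%E]_(z in D1 `*` D2) f z =
  \int[m1]_(x in D1) \int[m2]_(y in D2) f (x, y).
Proof.
rewrite Rintegral_mkcond [RHS]Rintegral_mkcond; congr fine.
rewrite -(integral12_prod_meas1 intf); apply: eq_integral => x _.
exact: f1.
Qed.

Lemma Rintegral_swap :
  \int[m1]_(x in D1) \int[m2]_(y in D2) f (x, y) =
  \int[m2]_(y in D2) \int[m1]_(x in D1) f (x, y).
Proof.
rewrite Rintegral_mkcond [RHS]Rintegral_mkcond; congr fine.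
under eq_integral do rewrite -f1.
by rewrite (Fubini intf); apply: eq_integral => y _; exact: f2.
Qed.

Lemma measurable_Rintegral_restrict :
  measurable_fun setT ((fun x => \int[m2]_(y in D2) f (x, y)) \_ D1).
Proof.
apply/measurable_EFinP.
rewrite [X in measurable_fun _ X](_ : _ =
  fubini_F m2 (EFin \o f \_ (D1 `*` D2))).
  exact: measurable_fubini_F intf.
by apply/funext => x; rewrite /fubini_F f1.
Qed.

End two_measures.

Lemma bounded_measurable_Rintegral (f : T1 * T2 -> R) : bounded_measurable f ->
  bounded_measurable (fun x => \int[m2]_(y in D2) f (x, y)).
Proof.
move=> bf; split.
  (* The claim involves no measure on [T1], so the Dirac mass at an arbitrary point serves as the
     first measure, with [D1 = setT] to make the restriction vacuous. *)
  have finT : (\d_(point : T1) [set: T1] < +oo :> \bar R)%E.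
    by rewrite diracT ltry.
  have := measurable_Rintegral_restrict measurableT finT bf.
  by rewrite patch_setT.
have [mf [M fM]] := bf; exists (M * fine (m2 D2)) => x.
by apply: bounded_Rintegral => //; exact: measurable_fun_pair2.
Qed.

End fubini_on_rectangles.

(** * Integral operators, their composition and trace over a set of measure one *)

Section kernel_algebra.
Context (R : realType) (d : measure_display) (T : measurableType d).
Variables (m : {sigma_finite_measure set T -> \bar R}) (D : set T).
Hypotheses (mD : measurable D) (m1 : m D = 1%E).

Implicit Types (A B W : T -> T -> R) (f g h : T -> R).

Let finD : (m D < +oo)%E. Proof. by rewrite m1 ltry. Qed.

Let int f : bounded_measurable f -> m.-integrable D (EFin \o f).
Proof. exact: bounded_measurable_integrable. Qed.

Definition bounded_kernel A := bounded_measurable (fun p : T * T => A p.1 p.2).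

Definition kernel_act A f (x : T) : R := \int[m]_(y in D) (A x y * f y).

(** The kernel of the composite of two integral operators. Letting [A] act on the columns of [B]
    reduces iterated composition to iterated action, column by column. *)
Definition kernel_comp A B (x z : T) : R := kernel_act A (B^~ z) x.

Definition kernel_trace A : R := \int[m]_(x in D) A x x.

Lemma bounded_kernel_cst (c : R) : bounded_kernel (fun _ _ => c).
Proof. exact: bounded_measurable_cst. Qed.

Lemma bounded_kernelB A B : bounded_kernel A -> bounded_kernel B ->
  bounded_kernel (fun x y => A x y - B x y).
Proof. exact: bounded_measurableB. Qed.

Lemma bounded_kernel_row A (x : T) : bounded_kernel A ->
  bounded_measurable (A x).
Proof. by move=> b; exact: bounded_measurable_comp b (pair1_measurable x). Qed.

Lemma bounded_kernel_col A (y : T) : bounded_kernel A ->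
  bounded_measurable (A^~ y).
Proof. by move=> b; exact: bounded_measurable_comp b (pair2_measurable y). Qed.

Lemma bounded_kernel_diag A : bounded_kernel A ->
  bounded_measurable (fun x => A x x).
Proof.
move=> bA; apply: (bounded_measurable_comp bA (g := fun x => (x, x))).
exact: measurable_fun_pair.
Qed.

Lemma bounded_act A f : bounded_kernel A -> bounded_measurable f ->
  bounded_measurable (kernel_act A f).
Proof.
move=> bA bf.
apply: (bounded_measurable_Rintegral mD finD
  (f := fun p => A p.1 p.2 * f p.2)) => //.
by apply: bounded_measurableM => //; exact: bounded_measurable_comp bf _.
Qed.

Lemma bounded_iter_act A f n : bounded_kernel A -> bounded_measurable f ->
  bounded_measurable (iter n (kernel_act A) f).
Proof. by move=> bA bf; elim: n => //= n; exact: bounded_act. Qed.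

Lemma bounded_comp A B : bounded_kernel A -> bounded_kernel B ->
  bounded_kernel (kernel_comp A B).
Proof.
move=> bA bB.
apply: (bounded_measurable_Rintegral mD finD
  (f := fun p : (T * T) * T => A p.1.1 p.2 * B p.2 p.1.2)) => //.
apply: bounded_measurableM.
  apply: (bounded_measurable_comp bA
    (g := fun p : (T * T) * T => (p.1.1, p.2))).
  by apply: measurable_fun_pair => //; exact: measurableT_comp.
apply: (bounded_measurable_comp bB (g := fun p : (T * T) * T => (p.2, p.1.2))).
by apply: measurable_fun_pair => //; exact: measurableT_comp.
Qed.

Lemma bounded_iter_comp A B n : bounded_kernel A -> bounded_kernel B ->
  bounded_kernel (iter n (kernel_comp A) B).
Proof. by move=> bA bB; elim: n => //= n; exact: bounded_comp. Qed.

Lemma actZ A f (c : R) : bounded_kernel A -> bounded_measurable f ->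
  kernel_act A (fun x => c * f x) = fun x => c * kernel_act A f x.
Proof.
move=> bA bf; apply/funext => x; rewrite /kernel_act -RintegralZl//.
  by apply: eq_Rintegral => y _; rewrite mulrCA.
by apply/int/bounded_measurableM => //; exact: bounded_kernel_row.
Qed.

Lemma actB A f g : bounded_kernel A -> bounded_measurable f ->
  bounded_measurable g ->
  kernel_act A (fun x => f x - g x) =
  fun x => kernel_act A f x - kernel_act A g x.
Proof.
move=> bA bf bg; apply/funext => x; rewrite /kernel_act -RintegralB//.
- by apply: eq_Rintegral => y _; rewrite mulrBr.
- by apply/int/bounded_measurableM => //; exact: bounded_kernel_row.
- by apply/int/bounded_measurableM => //; exact: bounded_kernel_row.
Qed.

Lemma iter_actZ A f (c : R) n : bounded_kernel A -> bounded_measurable f ->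
  iter n (kernel_act A) (fun x => c * f x) =
  fun x => c * iter n (kernel_act A) f x.
Proof.
by move=> bA bf; elim: n => //= n ->; rewrite actZ//; exact: bounded_iter_act.
Qed.

Lemma iter_actB A f g n : bounded_kernel A -> bounded_measurable f ->
  bounded_measurable g ->
  iter n (kernel_act A) (fun x => f x - g x) =
  fun x => iter n (kernel_act A) f x - iter n (kernel_act A) g x.
Proof.
move=> bA bf bg; elim: n => //= n ->; rewrite actB//; exact: bounded_iter_act.
Qed.

Lemma iter_compE A B n (x z : T) :
  iter n (kernel_comp A) B x z = iter n (kernel_act A) (B^~ z) x.
Proof.
elim: n x => //= n IH x; rewrite /kernel_comp; congr (kernel_act A _ x).
by apply/funext => y; exact: IH.
Qed.

(** Both sides are the double integral of A(x,y) B(y,z) f(z), taken in the two orders; Fubini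
    exchanges them. *)
Lemma act_act A B f : bounded_kernel A -> bounded_kernel B ->
  bounded_measurable f ->
  kernel_act A (kernel_act B f) = kernel_act (kernel_comp A B) f.
Proof.
move=> bA bB bf; apply/funext => x.
have bAx := bounded_kernel_row x bA.
transitivity (\int[m]_(y in D) \int[m]_(z in D) (A x y * (B y z * f z))).
  apply: eq_Rintegral => y _; rewrite RintegralZl//.
  by apply/int/bounded_measurableM => //; exact: bounded_kernel_row.
rewrite (Rintegral_swap mD finD mD finD
  (f := fun p : T * T => A x p.1 * (B p.1 p.2 * f p.2))); last first.
  apply: bounded_measurableM; first exact: bounded_measurable_comp bAx _.
  by apply: bounded_measurableM => //; exact: bounded_measurable_comp bf _.
apply: eq_Rintegral => z _; rewrite /kernel_comp /kernel_act/= -RintegralZr//.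
  by apply: eq_Rintegral => y _; rewrite mulrA.
by apply/int/bounded_measurableM => //; exact: bounded_kernel_col.
Qed.

Lemma iter_act_act A B f n : bounded_kernel A -> bounded_kernel B ->
  bounded_measurable f ->
  iter n (kernel_act A) (kernel_act B f) =
  kernel_act (iter n (kernel_comp A) B) f.
Proof.
move=> bA bB bf; elim: n => //= n ->; rewrite act_act//.
exact: bounded_iter_comp.
Qed.

(** After Fubini exchanges the two integrals, the integrands differ only in the order of the
    factors. *)
Lemma kernel_trace_compC A B : bounded_kernel A -> bounded_kernel B ->
  kernel_trace (kernel_comp A B) = kernel_trace (kernel_comp B A).
Proof.
move=> bA bB; rewrite /kernel_trace /kernel_comp /kernel_act.
rewrite (Rintegral_swap mD finD mD finD
  (f := fun p : T * T => A p.1 p.2 * B p.2 p.1)).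
  by apply: eq_Rintegral => y _; apply: eq_Rintegral => x _; rewrite mulrC.
apply: bounded_measurableM => //.
apply: (bounded_measurable_comp bB (g := fun p : T * T => (p.2, p.1))).
exact: measurable_fun_pair.
Qed.

(** * The five-cycle identity for a kernel W and its complement V = 1 - W *)

Section complementary_kernels.
Variables (W V : T -> T -> R).
Hypotheses (bW : bounded_kernel W) (VE : V = fun x y => 1 - W x y).

Let bV : bounded_kernel V.
Proof. by rewrite VE; apply/bounded_kernelB/bW/bounded_kernel_cst. Qed.

(** The qij of the overview. When one index is 0, this is the density of the path with [i + j] edges
    in the remaining kernel. *)
Definition mixed_path i j : R :=
  \int[m]_(x in D) iter i (kernel_act W) (iter j (kernel_act V) (fun=> 1)) x.

(** A closed walk with [i] edges W, [j] edges V and a closing edge [A]. The closing edge is kept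
    apart because it is the one expanded or rotated. *)
Definition mixed_cycle i j A : R :=
  kernel_trace (iter i (kernel_comp W) (iter j (kernel_comp V) A)).

Let b1 : bounded_measurable (fun=> 1 : R) := bounded_measurable_cst T 1.

Lemma mixed_path00 : mixed_path 0 0 = 1.
Proof. by rewrite /mixed_path/= Rintegral_cst//= m1 mulr1. Qed.

(** The constant kernel 1 sends [f] to the constant function with value its integral. The factor [1]
    is kept so that this term is a scalar times [fun=> 1], the shape that [iter_actZ] expects. *)
Lemma act_complement f : bounded_measurable f ->
  kernel_act V f = fun x => (\int[m]_(y in D) f y) * 1 - kernel_act W f x.
Proof.
move=> bf; apply/funext => x; rewrite mulr1 /kernel_act VE -RintegralB//.
- by apply: eq_Rintegral => y _; rewrite mulrBl mul1r.
- exact: int.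
- by apply/int/bounded_measurableM => //; exact: bounded_kernel_row.
Qed.

(** The V expanded is the one adjacent to the block of W, so the W replacing it joins that block. *)
Lemma mixed_pathS i j :
  mixed_path i j.+1 = mixed_path 0 j * mixed_path i 0 - mixed_path i.+1 j.
Proof.
have bVj := bounded_iter_act j bV b1.
have bWi := bounded_iter_act i bW b1.
rewrite {1}/mixed_path/= act_complement//.
rewrite iter_actB//; last 2 first.
- exact: bounded_measurableM (bounded_measurable_cst _ _) b1.
- exact: bounded_act.
rewrite iter_actZ// RintegralB//; last 2 first.
- exact/int/bounded_measurableM/bWi/bounded_measurable_cst.
- exact/int/bounded_iter_act/bounded_act.
by rewrite RintegralZl//; [rewrite -iterSr|exact: int].
Qed.

(** Every column of the constant kernel 1 is the function 1, so closing with that kernel leaves the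
    integral of W^i V^j 1: the cycle opens into a path. *)
Lemma mixed_cycle_complement i j :
  mixed_cycle i j V = mixed_path i j - mixed_cycle i j W.
Proof.
rewrite /mixed_cycle /kernel_trace /mixed_path -RintegralB//; last 2 first.
- exact/int/bounded_iter_act/bounded_iter_act.
- exact/int/bounded_kernel_diag/bounded_iter_comp/bounded_iter_comp.
apply: eq_Rintegral => x _; rewrite !iter_compE.
have colE B : (iter j (kernel_comp V) B)^~ x = iter j (kernel_act V) (B^~ x).
  by apply/funext => y; rewrite iter_compE.
rewrite !colE.
(* The constant is written as an applied function to match the pattern of [iter_actB]. *)
have -> : V^~ x = fun y => (fun=> 1) y - W^~ x y by rewrite VE.
have bWx := bounded_kernel_col x bW.
rewrite iter_actB// iter_actB//; exact: bounded_iter_act.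
Qed.

(** Cyclicity of the trace moves the closing W to the front, and by associativity the innermost V of
    the block becomes the new closing edge, ready to be expanded. *)
Lemma mixed_cycle_rot i j : mixed_cycle i j.+1 W = mixed_cycle i.+1 j V.
Proof.
have bX : bounded_kernel (iter i (kernel_comp W) (iter j (kernel_comp V) V)).
  by do 2 apply: bounded_iter_comp => //.
rewrite /mixed_cycle [RHS]/= kernel_trace_compC//; apply: eq_Rintegral => x _.
have bWx := bounded_kernel_col x bW.
rewrite iter_compE [RHS]/kernel_comp -iter_act_act//; last first.
  exact: bounded_iter_comp.
rewrite -iter_act_act// -iterSr; congr (iter i (kernel_act W) _ x).
by apply/funext => y; rewrite iter_compE.
Qed.

Lemma cycle5_complement :
  mixed_cycle 0 4 V + mixed_cycle 4 0 W =
  mixed_path 0 4 - mixed_path 1 3 + mixed_path 2 2 - mixed_path 3 1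
  + mixed_path 4 0.
Proof.
(* Each round trades one V for a W, with a change of sign. The fifth expansion leaves the cycle with
   all edges W; since five is odd, its sign is negative and it cancels the second summand. *)
do 4 rewrite mixed_cycle_complement mixed_cycle_rot.
rewrite mixed_cycle_complement; move: (mixed_cycle 4 0 W).
move: (mixed_path 0 4) (mixed_path 1 3) (mixed_path 2 2) (mixed_path 3 1).
by move: (mixed_path 4 0) => q40 q04 q13 q22 q31 c; ring.
Qed.

Lemma cycle5_identity :
  mixed_cycle 4 0 W + mixed_cycle 0 4 V =
  (mixed_path 1 0 ^+ 5 + 5 * mixed_path 1 0 * mixed_path 4 0
   - 5 * mixed_path 1 0 ^+ 2 * mixed_path 3 0) +
  (mixed_path 0 1 ^+ 5 + 5 * mixed_path 0 1 * mixed_path 0 4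
   - 5 * mixed_path 0 1 ^+ 2 * mixed_path 0 3).
Proof.
(* Each use of [mixed_pathS] lowers the second index, so everything reduces to the four values with
   second index 0, together with q00 = 1. *)
rewrite addrC cycle5_complement !mixed_pathS mixed_path00.
move: (mixed_path 1 0) (mixed_path 2 0) (mixed_path 3 0) (mixed_path 4 0).
by move=> q1 q2 q3 q4; ring.
Qed.

End complementary_kernels.
End kernel_algebra.

(** * Walk weights and iterated integration over tuples *)

Fixpoint walk (R : pzRingType) (T : Type) (W : T -> T -> R) (x : T)
    (s : seq T) : R :=
  if s is y :: s' then W x y * walk W y s' else 1.

(** Entry [i] of [s] is entry [i.+1] of [x :: s], so the factors run over consecutive vertices. The
    recursive form suits integrating out the first coordinate; the product form serves measurability
    and the comparison with edge products. *)
Lemma walk_prod (R : pzRingType) (T : Type) (W : T -> T -> R) (x0 x : T)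
    (s : seq T) :
  walk W x s = \prod_(i < size s) W (nth x0 (x :: s) i) (nth x0 s i).
Proof.
by elim: s x => [|y s IH] x; rewrite ?big_ord0// big_ord_recl/= -IH.
Qed.

Section tuple_integrals.
Context (R : realType) (d : measure_display) (T : measurableType d).
Variables (m : {sigma_finite_measure set T -> \bar R}) (D : set T).
Hypotheses (mD : measurable D) (m1 : m D = 1%E).

Definition tuple_cube n : set (n.-tuple T) := [set t | forall i, D (tnth t i)].

Lemma preimage_pair_cons_cube n :
  @pair_cons _ T n @^-1` @tuple_cube n.+1 = D `*` @tuple_cube n.
Proof.
apply/seteqP; split=> [[x t]/= xtD|[x t]/= [xD tD] i].
  split=> [|i]; first by have := xtD ord0; rewrite tnth0.
  by have := xtD (lift ord0 i); rewrite tnthS.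
by case: (unliftP ord0 i) => [j ->|->]; rewrite ?tnthS ?tnth0.
Qed.

Lemma measurable_tuple_cube n : measurable (@tuple_cube n).
Proof.
elim: n => [|n IH].
  by rewrite (_ : @tuple_cube 0 = setT)// -subTset => t _ [].
rewrite (_ : @tuple_cube n.+1 = @uncons _ T n @^-1` (D `*` @tuple_cube n)).
  rewrite -[X in measurable X]setTI; apply: measurable_uncons => //.
  exact: measurableX.
rewrite -preimage_pair_cons_cube -comp_preimage.
rewrite (_ : _ \o _ = id) ?preimage_id//; apply/funext => t.
by rewrite /= /pair_cons /uncons [RHS]tuple_eta.
Qed.

Lemma tuple_measure_cube n : tuple_measure m n (@tuple_cube n) = 1%E.
Proof.
elim: n => [|n IH].
  by rewrite /= diracE mem_set// => -[].
rewrite /= /cons_measure /pushforward preimage_pair_cons_cube.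
rewrite product_measure1E//; last exact: measurable_tuple_cube.
by rewrite [X in (_ * X)%E]IH mule1 -m1.
Qed.

Lemma tuple_measure_cube_fin n : (tuple_measure m n (@tuple_cube n) < +oo)%E.
Proof. by rewrite tuple_measure_cube ltry. Qed.

Lemma Rintegral_tuple0 (f : 0.-tuple T -> R) :
  \int[tuple_measure m 0]_(t in @tuple_cube 0) f t = f [tuple].
Proof.
transitivity (\int[tuple_measure m 0]_(t in @tuple_cube 0) f [tuple]).
  by apply: eq_Rintegral => t _; rewrite tuple0.
rewrite Rintegral_cst ?[X in fine X]tuple_measure_cube ?mulr1//.
exact: measurable_tuple_cube.
Qed.

(** [tuple_measure] is the pushforward of a product measure along [pair_cons]: change variables,
    then apply Fubini. *)
Lemma Rintegral_tupleS n (f : n.+1.-tuple T -> R) : bounded_measurable f ->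
  \int[tuple_measure m n.+1]_(t in @tuple_cube n.+1) f t =
  \int[m]_(x in D) \int[tuple_measure m n]_(t in @tuple_cube n)
    f (pair_cons (x, t)).
Proof.
move=> bf; have mC := measurable_tuple_cube.
have bfc := bounded_measurable_comp bf (@measurable_pair_cons _ T n).
have fin1 : (m D < +oo)%E by rewrite m1 ltry.
rewrite -(Rintegral_setX (mC n) (tuple_measure_cube_fin n) mD fin1 bfc).
rewrite -preimage_pair_cons_cube; congr fine.
have mf : measurable_fun setT (EFin \o f) by apply/measurable_EFinP; case: bf.
rewrite (integral_pushforward (@measurable_pair_cons _ T n) mf)//; last first.
  exact: mC.
apply: bounded_measurable_integrable => //.
  rewrite preimage_pair_cons_cube; exact: measurableX.
exact: tuple_measure_cube_fin n.+1.
Qed.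

Lemma measurable_nth n (x0 : T) i :
  measurable_fun setT (fun t : n.-tuple T => nth x0 t i).
Proof.
have [ni|ni] := ltnP i n; last first.
  rewrite (_ : (fun t => _) = fun=> x0); first exact: measurable_cst.
  by apply/funext => t; rewrite nth_default// size_tuple.
rewrite (_ : (fun t => _) = (fun t => tnth t (Ordinal ni))).
  exact: measurable_tnth.
by apply/funext => t; rewrite (tnth_nth x0).
Qed.

Lemma measurable_nth_cons n (x0 : T) i :
  measurable_fun setT (fun t : n.-tuple T => nth x0 (x0 :: t) i).
Proof. by case: i => [|i]; [exact: measurable_cst|exact: measurable_nth]. Qed.

Lemma bounded_edge n (W : T -> T -> R) (p q : n.-tuple T -> T) :
  bounded_kernel W -> measurable_fun setT p -> measurable_fun setT q ->
  bounded_measurable (fun t => W (p t) (q t)).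
Proof.
move=> bW mp mq.
apply: (bounded_measurable_comp bW (g := fun t => (p t, q t))).
exact: measurable_fun_pair.
Qed.

Lemma bounded_walk (W : T -> T -> R) (h : T -> R) n (x : T) :
  bounded_kernel W -> bounded_measurable h ->
  bounded_measurable (fun t : n.-tuple T => walk W x t * h (last x t)).
Proof.
move=> bW bh; apply: bounded_measurableM.
  under eq_fun do rewrite (walk_prod W x) size_tuple.
  apply: bounded_measurable_prod => i _; apply: bounded_edge => //.
    exact: measurable_nth_cons.
  exact: measurable_nth.
apply: bounded_measurable_comp bh _.
rewrite (_ : (fun t => _) = (fun t : n.-tuple T => nth x (x :: t) n)).
  exact: measurable_nth_cons.
by apply/funext => t; rewrite (last_nth x) size_tuple.
Qed.

(** Integrating out the first tuple coordinate peels off one application of the operator. The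
    endpoint weight [h] serves two purposes: the constant 1 gives a path, and the column of [W] at
    the starting point closes a cycle. *)
Lemma Rintegral_walk (W : T -> T -> R) (h : T -> R) n (x : T) :
  bounded_kernel W -> bounded_measurable h ->
  \int[tuple_measure m n]_(t in @tuple_cube n) (walk W x t * h (last x t)) =
  iter n (kernel_act m D W) h x.
Proof.
move=> bW bh; elim: n x => [|n IH] x; first by rewrite Rintegral_tuple0 mul1r.
rewrite Rintegral_tupleS; last exact: bounded_walk.
rewrite iterS [RHS]/kernel_act; apply: eq_Rintegral => y _.
rewrite -IH -RintegralZl//.
- by apply: eq_Rintegral => t _; rewrite mulrA.
- exact: measurable_tuple_cube.
- apply: bounded_measurable_integrable; last exact: bounded_walk.
    exact: measurable_tuple_cube.
  exact: tuple_measure_cube_fin.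
Qed.

End tuple_integrals.

(** * Densities of paths and of the five-cycle in operator form *)

Section hom_density.
Variable R : realType.
Implicit Types W : R -> R -> R.

Local Notation mu := (@lebesgue_measure R).
Let I : set R := `[0, 1].

Lemma measurable_unit_itv : measurable I.
Proof. exact: measurable_itv. Qed.

Lemma lebesgue_measure_unit_itv : mu I = 1%E.
Proof. by rewrite /I lebesgue_measure_itv/= lte01 sube0. Qed.

Let mI := measurable_unit_itv.
Let mu1 := lebesgue_measure_unit_itv.

Lemma hom_density_ord n (e : rel 'I_n) (se : symmetric e) (ie : irreflexive e)
    W :
  hom_density (SGraph se ie) W =
  \int[tuple_measure mu n]_(t in tuple_cube I (n := n))
    \prod_(p : 'I_n * 'I_n | e p.1 p.2 && (p.1 < p.2)%N)
      W (nth 0 t p.1) (nth 0 t p.2).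
Proof.
rewrite /hom_density /=.
under eq_Rintegral => x _.
  under eq_bigl do rewrite !enum_rank_ord/=.
  under eq_bigr do rewrite !(tnth_nth 0) !enum_rank_ord/=.
  over.
(* With [nth] in place of [tnth], no index has a type depending on the cardinal of ['I_n], so that
   cardinal can be rewritten to [n] even in the tuple type. *)
by move: (card_ord n) => /= ->.
Qed.

Lemma eq_hom_density (H : sgraph) (U W : R -> R -> R) :
  {in `[0, 1] &, forall x y, U x y = W x y} ->
  hom_density H U = hom_density H W.
Proof.
move=> UW; apply: eq_Rintegral => x /set_mem xI.
by apply: eq_bigr => p _; exact: UW.
Qed.

Lemma bounded_edges n (P : pred ('I_n * 'I_n)) W : bounded_kernel W ->
  bounded_measurable (fun t : n.-tuple R =>
    \prod_(p | P p) W (nth 0 t p.1) (nth 0 t p.2)).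
Proof.
move=> bW; apply: bounded_measurable_prod => p _.
by apply: bounded_edge => //; exact: measurable_nth.
Qed.

Lemma prod_path_edges n (g : nat -> nat -> R) :
  \prod_(p : 'I_n.+1 * 'I_n.+1 | path_adj p.1 p.2 && (p.1 < p.2)%N)
    g p.1 p.2 = \prod_(i < n) g i i.+1.
Proof.
rewrite -(pair_big_dep xpredT
  (fun i j : 'I_n.+1 => path_adj i j && (i < j)%N) (fun i j => g i j))/=.
have adjE (i j : 'I_n.+1) : path_adj i j && (i < j)%N = (i.+1 == j :> nat).
  rewrite /path_adj; apply/andP/eqP => [[/orP[/eqP//|/eqP <-]]|<-].
    by rewrite ltnNge leqnSn.
  by rewrite eqxx ltnSn.
under eq_bigr do under eq_bigl do rewrite adjE.
(* The last vertex has no successor, so its inner product is empty. Any other vertex [i] has the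
   single successor [lift ord0 i], of value [i.+1]. *)
rewrite big_ord_recr/= [X in _ * X]big_pred0 ?mulr1; last first.
  by move=> j; rewrite gtn_eqF.
by apply: eq_bigr => i _; rewrite (big_pred1 (lift ord0 i)).
Qed.

Lemma path_edges_walk n W (x : R) (t : n.-tuple R) :
  \prod_(p : 'I_n.+1 * 'I_n.+1 | path_adj p.1 p.2 && (p.1 < p.2)%N)
    W (nth 0 (x :: t) p.1) (nth 0 (x :: t) p.2) = walk W x t.
Proof.
rewrite (prod_path_edges n
  (fun i j => W (nth 0 (x :: t) i) (nth 0 (x :: t) j))).
by rewrite (walk_prod W 0) size_tuple.
Qed.

Lemma hom_density_path n W : bounded_kernel W ->
  hom_density (path_graph n.+1) W =
  \int[mu]_(x in I) iter n (kernel_act mu I W) (fun=> 1) x.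
Proof.
move=> bW; rewrite hom_density_ord Rintegral_tupleS//; last first.
  exact: bounded_edges.
apply: eq_Rintegral => x _.
rewrite -(Rintegral_walk (m := mu) mI mu1)//; last first.
  exact: bounded_measurable_cst.
by apply: eq_Rintegral => t _; rewrite mulr1; exact: (path_edges_walk W x t).
Qed.

Lemma hom_density_K2 W :
  hom_density (complete_graph 2) W = hom_density (path_graph 2) W.
Proof.
rewrite !hom_density_ord; apply: eq_Rintegral => t _; apply: eq_bigl.
by move=> [[[|[|i]] //= hi] [[|[|j]] //= hj]].
Qed.

(** The right-hand side is grouped as [walk] unfolds, followed by the closing edge, which is
    oriented from 0 to 4 because the smaller index comes first. *)
Lemma prod_cycle5_edges (g : nat -> nat -> R) :
  \prod_(p : 'I_5 * 'I_5 | cycle_adj p.1 p.2 && (p.1 < p.2)%N) g p.1 p.2 =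
  g 0 1 * (g 1 2 * (g 2 3 * g 3 4)) * g 0 4.
Proof.
rewrite -(pair_big_dep xpredT
  (fun i j : 'I_5 => cycle_adj i j && (i < j)%N) (fun i j => g i j))/=.
under eq_bigr do rewrite big_mkcond.
by rewrite !big_ord_recl !big_ord0 /cycle_adj /= /bump/=; ring.
Qed.

Lemma cycle5_edges_walk W (x : R) (t : 4.-tuple R) :
  \prod_(p : 'I_5 * 'I_5 | cycle_adj p.1 p.2 && (p.1 < p.2)%N)
    W (nth 0 (x :: t) p.1) (nth 0 (x :: t) p.2) = walk W x t * W x (last x t).
Proof.
rewrite (prod_cycle5_edges
  (fun i j => W (nth 0 (x :: t) i) (nth 0 (x :: t) j))).
by case: t => -[|a [|b [|c [|e [|? ?]]]]] //= _; rewrite mulr1.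
Qed.

Lemma hom_density_cycle5 W : bounded_kernel W -> (forall x y, W x y = W y x) ->
  hom_density (cycle_graph 5) W =
  kernel_trace mu I (iter 4 (kernel_comp mu I W) W).
Proof.
move=> bW sW; rewrite hom_density_ord Rintegral_tupleS//; last first.
  exact: bounded_edges.
apply: eq_Rintegral => x _; have bWx := bounded_kernel_col x bW.
rewrite iter_compE -(Rintegral_walk (m := mu) mI mu1)//.
(* The column of [W] at [x] yields the closing edge directed towards [x], while the edge product has
   it leaving [x]; symmetry reconciles them. *)
by apply: eq_Rintegral => t _; rewrite -sW; exact: (cycle5_edges_walk W x t).
Qed.

(** [is_kernel] constrains values on the unit square only, whereas [bounded_kernel] is a condition
    on the whole plane. Extension by zero achieves it without changing any density. *)
Definition restrict_kernel W (x y : R) : R :=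
  ((fun p : R * R => W p.1 p.2) \_ (I `*` I)) (x, y).

Lemma restrict_kernelE W :
  {in `[0, 1] &, forall x y, restrict_kernel W x y = W x y}.
Proof. by move=> x y xI yI; rewrite /restrict_kernel patchE mem_set. Qed.

Lemma bounded_restrict_kernel W : is_kernel W ->
  bounded_kernel (restrict_kernel W).
Proof.
move=> [mW [M WM] _]; split.
  rewrite (_ : (fun p => _) = (fun p : R * R => W p.1 p.2) \_ (I `*` I)).
    by apply: (iffLR (measurable_restrictT _ _)) mW; exact: measurableX.
  by apply/funext => -[].
(* The absolute value makes the bound visibly nonnegative, which covers the zero values off the
   square. *)
exists `|M| => -[x y]; rewrite /restrict_kernel patchE.
case: ifPn => [/set_mem[/= xI yI]|_]; last by rewrite normr0.
by rewrite (le_trans (WM _ _ xI yI))// ler_norm.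
Qed.

Lemma restrict_kernel_sym W : is_kernel W ->
  forall x y, restrict_kernel W x y = restrict_kernel W y x.
Proof.
move=> [_ _ sW] x y; rewrite /restrict_kernel !patchE !in_setX/= andbC.
by case: ifPn => // /andP[/set_mem yI /set_mem xI]; exact: sW.
Qed.

End hom_density.

Theorem theorem2p4 (R : realType) (W1 W2 : R -> R -> R)
  (hW1 : is_kernel W1) (hW2 : is_kernel W2)
  (hW : forall x y : R, x \in `[0, 1] -> y \in `[0, 1] -> W1 x y + W2 x y = 1) :
  hom_density (cycle_graph 5) W1 + hom_density (cycle_graph 5) W2 =
  \sum_(W <- [:: W1; W2])
    (hom_density (complete_graph 2) W ^+ 5
     + 5 * hom_density (complete_graph 2) W * hom_density (path_graph 5) W
     - 5 * hom_density (complete_graph 2) W ^+ 2 * hom_density (path_graph 4) W).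
Proof.
(* [V] is not the zero extension of [W2]: it equals 1 off the unit square, so that V = 1 - W holds
   everywhere, as [cycle5_identity] demands. On the square it agrees with [W2] by [hW]. *)
pose W := restrict_kernel W1; pose V x y := 1 - W x y.
have bW : bounded_kernel W by exact: bounded_restrict_kernel.
have bV : bounded_kernel V.
  by apply: bounded_kernelB => //; exact: bounded_kernel_cst.
have sW := restrict_kernel_sym hW1.
have sV x y : V x y = V y x by rewrite /V /W sW.
have W1E H : hom_density H W1 = hom_density H W.
  by apply: eq_hom_density => x y xI yI; rewrite /W restrict_kernelE.
have W2E H : hom_density H W2 = hom_density H V.
  apply: eq_hom_density => x y xI yI.
  by rewrite /V /W restrict_kernelE// -(hW x y xI yI) addrC addKr.
rewrite big_cons big_seq1 !W1E !W2E !hom_density_K2.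
rewrite !hom_density_cycle5// !hom_density_path//.
exact: (cycle5_identity (m := @lebesgue_measure R) (@measurable_unit_itv R)
  (@lebesgue_measure_unit_itv R) bW erefl).
Qed.
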